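(* Suppose the empirical marginal density $f$ is the $N(0,\tau^2)$ density, so that $l'(z)=-z/\tau^2$. Then the approximate-risk minimizer yields a shrinkage-only rule with \[ c(|\check z|)=0,\qquad \hat\theta_{\mathrm{NOMAD}}=(1-\tau^{-2})\check z . \] Under the empirical-Bayes substitution of the unknown shrinkage level $\tau^{-2}$ by its James--Stein estimate $(d-2)/\|\check z\|_2^2$, this profile reduces to the James--Stein rule \[ \hat\theta_{\mathrm{JS}}=\Bigl(1-\frac{d-2}{\|\check z\|_2^2}\Bigr)\check z . \] Equivalently, the induced rule belongs to the ridge-type shrinkage family.
   Context: Model: $Z\sim N(\theta,I_d)$, observed value $\check z\in\mathbb R^d$. For $z\in\mathbb R^d$, $|z|=(|z_1|,\dots,|z_d|)$. $f$ is the coordinatewise marginal density of the observations and $l'=(\log f)'$. For functionals $t,c\ge0$ of $|z|$, the approximate risk is $\hat R(t,c;\check z)=d+\int_{\mathbb R^d}\hat H\,dz$ with \[ \hat H=-\sum_{i=1}^d\frac{1}{|z_i|^{c}}\Bigl(2|z_i|\frac{\partial t}{\partial|z_i|}-2t|z_i|\ln|z_i|\frac{\partial c}{\partial|z_i|}+2t(1-c)-t^2|z_i|^{2-c}\Bigr)\prod_{j=1}^d\phi\bigl(z_j-\check z_j-l'(\check z_j)\bigr), \] $t=t(|z|)$, $c=c(|z|)$, $\phi$ the standard normal density. $\mathcal F$ is the class of pairs $(t,c)$ whose partial derivatives exist a.e. and for which these integrals are well defined. $(\tilde t,\tilde c)$ is a minimizer of $\hat R(\cdot,\cdot;\check z)$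 over $\mathcal F$, characterized in the paper by the optimality conditions (at $\check z$, with $c=c(|\check z|)$) \[ t(|\check z|)=-\frac{\sum_i\mathrm{sgn}(\check z_i)|\check z_i|^{1-c}l'(\check z_i)}{\sum_i|\check z_i|^{2-2c}},\qquad \frac{\sum_i\mathrm{sgn}(\check z_i)|\check z_i|^{1-c}l'(\check z_i)}{\sum_i|\check z_i|^{2-2c}}=\frac{\sum_i\mathrm{sgn}(\check z_i)|\check z_i|^{1-c}\ln|\check z_i|\,l'(\check z_i)}{\sum_i|\check z_i|^{2-2c}\ln|\check z_i|}. \] The NOMAD estimator has coordinates $\hat\theta_{\mathrm{NOMAD},i}=\check z_i-\tilde t(|\check z|)\,\mathrm{sgn}(\check z_i)|\check z_i|^{1-\tilde c(|\check z|)}$. The ridge-type shrinkage family consists of linear shrinkage rules $\check z\mapsto\bigl(1-\frac{\lambda}{1+\lambda}\bigr)\check z$, $\lambda>0$ (the GEST rules with constant $t=\lambda/(1+\lambda)$ and $c=0$).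
   Formalization: All coordinates of ž are taken nonzero (ln|ž_i| must exist); c=0 is forced only if the |ž_i| are not all equal (otherwise the optimality conditions leave c free; the estimator formula still holds); ridge-family membership is stated for τ²>1, since it fails for τ≤1. *)

(* Defs.v *)
From HB Require Import structures.
From mathcomp Require Import all_boot all_order all_algebra.
From mathcomp Require Import all_classical all_reals all_analysis.
Import Order.TTheory GRing.Theory Num.Theory.
Import numFieldNormedType.Exports.

Set Implicit Arguments.
Unset Strict Implicit.
Unset Printing Implicit Defensive.

Local Open Scope classical_set_scope.
Local Open Scope ring_scope.

(* MathComp-Analysis.  Vectors of R^d are row vectors 'rV[R]_d; for integration
   they are tuples, which carry the product (Borel) sigma-algebra. *)

Section lebesgue_tuple.
Context {R : realType}.
Local Notation Rm := (measurableTypeR R).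

Definition uncurry_cons n (xv : Rm * n.-tuple Rm) : n.+1.-tuple Rm :=
  [tuple of xv.1 :: xv.2].

Lemma measurable_uncurry_cons n :
  measurable_fun [set: Rm * n.-tuple Rm] (@uncurry_cons n).
Proof. exact: measurable_cons. Qed.

Section lebesgue_cons.
Variables (n : nat) (mu : {sigma_finite_measure set (n.-tuple Rm) -> \bar R}).

Definition lebesgue_cons : set (n.+1.-tuple Rm) -> \bar R :=
  pushforward (@lebesgue_measure R \x mu)%E (@uncurry_cons n).

Let lebesgue_cons0 : lebesgue_cons set0 = 0%E.
Proof. by rewrite /lebesgue_cons /pushforward preimage_set0 measure0. Qed.

Let lebesgue_cons_ge0 A : (0 <= lebesgue_cons A)%E.
Proof. by rewrite /lebesgue_cons /pushforward; apply: measure_ge0. Qed.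

Let lebesgue_cons_sigma_additive : semi_sigma_additive lebesgue_cons.
Proof.
move=> F mF tF mUF; rewrite /lebesgue_cons /pushforward preimage_bigcup.
apply: measure_semi_sigma_additive.
- by move=> k; rewrite -[X in measurable X]setTI; exact: measurable_uncurry_cons.
- apply/trivIsetP => /= i j _ _ ij; rewrite -preimage_setI.
  by move/trivIsetP : tF => /(_ _ _ _ _ ij) ->//; rewrite preimage_set0.
- rewrite -preimage_bigcup -[X in measurable X]setTI.
  exact: measurable_uncurry_cons.
Qed.

HB.instance Definition _ := isMeasure.Build _ _ _ lebesgue_cons
  lebesgue_cons0 lebesgue_cons_ge0 lebesgue_cons_sigma_additive.

Let lebesgue_cons_sigma_finite : sigma_finite setT lebesgue_cons.
Proof.
have /sigma_finiteP[F [TF ndF Foo]] := sigma_finiteT (@lebesgue_measure R).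
have /sigma_finiteP[G [TG ndG Goo]] := sigma_finiteT mu.
pose U k : set (n.+1.-tuple Rm) :=
  [set v | F k (thead v) /\ G k [tuple of behead v]].
exists U.
  apply/esym; rewrite -subTset => v _.
  have [k _ Fk] : (\bigcup_k F k) (thead v) by rewrite -TF.
  have [l _ Gl] : (\bigcup_k G k) [tuple of behead v] by rewrite -TG.
  exists (maxn k l) => //; split => /=.
    by move: Fk; apply/subsetPset/ndF; rewrite leq_maxl.
  by move: Gl; apply/subsetPset/ndG; rewrite leq_maxr.
move=> k; have [mF Fk] := Foo k; have [mG Gk] := Goo k; split.
  apply: (@measurableI _ _ (@thead _ _ @^-1` F k)).
    by rewrite -[X in measurable X]setTI; exact: measurable_tnth.
  by rewrite -[X in measurable X]setTI; exact: measurable_behead.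
rewrite /lebesgue_cons /pushforward.
rewrite (_ : _ @^-1` _ = F k `*` G k); last first.
  apply/funext => -[x v]; rewrite /U /preimage /uncurry_cons /= theadE.
  by rewrite (_ : [tuple of _] = v)//; exact/val_inj.
by rewrite product_measure1E// lte_mul_pinfty// ge0_fin_numE.
Qed.

HB.instance Definition _ := Measure_isSigmaFinite.Build _ _ _ lebesgue_cons
  lebesgue_cons_sigma_finite.

End lebesgue_cons.

(* Lebesgue measure on R^d: R^0 is a point of mass 1, R^(n+1) = R x R^n. *)
Fixpoint lebesgue_tuple n : {sigma_finite_measure set (n.-tuple Rm) -> \bar R} :=
  match n return {sigma_finite_measure set (n.-tuple Rm) -> \bar R} with
  | 0 => \d_([tuple] : 0.-tuple Rm)
  | n'.+1 => lebesgue_cons (lebesgue_tuple n')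
  end.

End lebesgue_tuple.

Section model.
Context {R : realType} (d : nat).
Implicit Types (z zc : 'rV[R]_d) (t c : 'rV[R]_d -> R) (f lp : R -> R).

Definition vabs z : 'rV[R]_d := \row_i `|z 0 i|.

Definition sqnorm2 z : R := \sum_i z 0 i ^+ 2.

Definition score f : R -> R := derive1 (fun x => ln (f x)).

(* A functional of |z| is a map t read only at points vabs z, so that
   'D_(delta_mx 0 i) t (vabs z) is the derivative of t with respect to |z_i|. *)
Definition Hhat lp zc t c z : R :=
  let a := vabs z in
  - (\sum_i (a 0 i `^ c a)^-1 *
       (2 * a 0 i * 'D_(delta_mx 0 i) t a
        - 2 * t a * a 0 i * ln (a 0 i) * 'D_(delta_mx 0 i) c a
        + 2 * t a * (1 - c a)
        - t a ^+ 2 * a 0 i `^ (2 - c a)))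
  * \prod_j normal_pdf 0 1 (z 0 j - zc 0 j - lp (zc 0 j)).

Definition row_of_tuple (v : d.-tuple (measurableTypeR R)) : 'rV[R]_d :=
  \row_i tnth v i.

Definition Rhat lp zc t c : R :=
  d%:R + \int[lebesgue_tuple d]_v Hhat lp zc t c (row_of_tuple v).

Definition gest_class lp zc t c : Prop :=
  [/\ forall z, 0 <= t (vabs z),
      forall z, 0 <= c (vabs z),
      {ae lebesgue_tuple d, forall v, let a := vabs (row_of_tuple v) in
         forall i, derivable t a (delta_mx 0 i) /\
                   derivable c a (delta_mx 0 i)} &
      (lebesgue_tuple d).-integrable setT
        (fun v => (Hhat lp zc t c (row_of_tuple v))%:E)].

Definition minimizes_Rhat lp zc
    (G : ('rV[R]_d -> R) -> ('rV[R]_d -> R) -> Prop) t c : Prop :=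
  G t c /\ forall t' c', G t' c' -> Rhat lp zc t c <= Rhat lp zc t' c'.

Definition optimality_conditions lp zc t c : Prop :=
  let c0 := c (vabs zc) in
  let num := \sum_i Num.sg (zc 0 i) * `|zc 0 i| `^ (1 - c0) * lp (zc 0 i) in
  let den := \sum_i `|zc 0 i| `^ (2 - 2 * c0) in
  let num_ln := \sum_i Num.sg (zc 0 i) * `|zc 0 i| `^ (1 - c0)
                       * ln `|zc 0 i| * lp (zc 0 i) in
  let den_ln := \sum_i `|zc 0 i| `^ (2 - 2 * c0) * ln `|zc 0 i| in
  t (vabs zc) = - (num / den) /\ num / den = num_ln / den_ln.

(* The admissible class G is a parameter, required only to lie inside
   gest_class: integrability and a.e. differentiability alone do not bound Rhat
   from below (take t an oscillating function with jumps), so gest_class itself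
   need not contain a minimizer.  The optimality conditions are evaluated at the
   observation zc, where minimality, an a.e. notion, gives no information. *)
Definition NOMAD_tuning lp zc
    (G : ('rV[R]_d -> R) -> ('rV[R]_d -> R) -> Prop) t c : Prop :=
  [/\ forall t' c', G t' c' -> gest_class lp zc t' c',
      minimizes_Rhat lp zc G t c & optimality_conditions lp zc t c].

Definition theta_NOMAD t c zc : 'rV[R]_d :=
  \row_i (zc 0 i - t (vabs zc) * Num.sg (zc 0 i)
                   * `|zc 0 i| `^ (1 - c (vabs zc))).

Definition shrinkage_profile (s : R) zc : 'rV[R]_d := (1 - s) *: zc.

Definition JS_level zc : R := (d%:R - 2) / sqnorm2 zc.

Definition theta_JS zc : 'rV[R]_d := (1 - (d%:R - 2) / sqnorm2 zc) *: zc.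

Definition ridge_family : set ('rV[R]_d -> 'rV[R]_d) :=
  [set r | exists2 lambda : R, 0 < lambda &
             forall zc, r zc = (1 - lambda / (1 + lambda)) *: zc].

End model.

(* Main.v *)
(* For l'(z) = - z / tau^2 the numerators of the optimality conditions are, up
   to the factor - tau^-2, the sums of a_i^(2-c) and a_i^(2-c) ln a_i over
   a_i = |z_i|.  With the weights w_i = a_i^(2-2c), the second condition says
   that a_i^c and ln a_i have zero w-covariance.  For c > 0 both are strictly
   increasing in a_i, so Chebyshev's sum inequality is strict unless all the a_i
   coincide.  Hence c = 0, and t = tau^-2, unless all the a_i equal a common
   value a; in that case c is undetermined but t = tau^-2 a^c, and the factor
   a^c cancels in the estimator. *)
Require Import Defs.
From HB Require Import structures.
From mathcomp Require Import all_boot all_order all_algebra.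
From mathcomp Require Import all_classical all_reals all_analysis.
From mathcomp Require Import ring lra.
Import Order.TTheory GRing.Theory Num.Theory.
Import numFieldNormedType.Exports.
Local Open Scope ring_scope.

(** Identity behind Chebyshev's sum inequality: the expanded product has two diagonal and two cross
    terms, each pair equal after swapping [i] and [j]. *)
Lemma weighted_covariance_double_sum (R : comRingType) (I : finType)
    (w x y : I -> R) :
  \sum_i \sum_j w i * w j * ((x i - x j) * (y i - y j)) =
  2 * ((\sum_i w i) * (\sum_i w i * x i * y i)
       - (\sum_i w i * x i) * (\sum_i w i * y i)).
Proof.
transitivity (\sum_i \sum_j
    ((w i * x i * y i) * w j + w i * (w j * x j * y j)
     - ((w i * x i) * (w j * y j) + (w i * y i) * (w j * x j)))).
  by apply: eq_bigr => i _; apply: eq_bigr => j _; ring.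
under eq_bigr => i _ do rewrite sumrB !big_split.
rewrite sumrB !big_split /= -!big_distrlr /=; ring.
Qed.

(** Equality case of Chebyshev: every term of the double sum is nonnegative, and positive where [x]
    differs, so a zero sum leaves no such pair. *)
Lemma eq_of_weighted_covariance0 (R : realDomainType) (I : finType)
    (w x y : I -> R) :
  (forall i, 0 < w i) ->
  (forall i j, x i < x j -> y i < y j) ->
  (\sum_i w i * x i) * (\sum_i w i * y i)
    = (\sum_i w i) * (\sum_i w i * x i * y i) ->
  forall i j, x i = x j.
Proof.
move=> w0 xy cov0 i j.
have term_gt0 k l : x k != x l -> 0 < (x k - x l) * (y k - y l).
  by case: (ltgtP (x k) (x l)) => // /[dup] /xy; nra.
have term_ge0 k l : 0 <= w k * w l * ((x k - x l) * (y k - y l)).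
  apply: mulr_ge0; first by rewrite mulr_ge0 ?ltW.
  by have [->|/term_gt0/ltW//] := eqVneq (x k) (x l); rewrite subrr mul0r.
have := weighted_covariance_double_sum R I w x y.
rewrite cov0 subrr mulr0 => /eqP.
rewrite psumr_eq0; last by move=> k _; apply: sumr_ge0.
move=> /allP/(_ i (mem_index_enum _))/=.
rewrite psumr_eq0// => /allP/(_ j (mem_index_enum _))/=.
apply: contraTeq => /term_gt0 h.
by rewrite gt_eqF// mulr_gt0// mulr_gt0.
Qed.

Lemma score_normal_pdf (R : realType) (tau x : R) : tau != 0 ->
  score (normal_pdf 0 tau) x = - x / tau ^+ 2.
Proof.
move=> tau0; rewrite /score.
have -> : (fun y => ln (normal_pdf 0 tau y))
    = (fun y => ln (normal_peak tau) - (2 * tau ^+ 2)^-1 * y ^+ 2).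
  apply/funext => y; rewrite normal_pdfE//.
  rewrite lnM ?posrE ?normal_peak_gt0 ?expR_gt0// expRK subr0.
  by congr (_ + _); field.
rewrite derive1E; apply: derive_val; apply: is_derive_eq.
rewrite /GRing.scale /=; field.
by rewrite tau0.
Qed.

Section linear_score.
Context {R : realType} {d : nat} (s : R) (lp : R -> R).
Hypothesis lpE : forall x, lp x = - (s * x).
Implicit Types (zc : 'rV[R]_d) (t c : 'rV[R]_d -> R).

(** Since [x] is its sign times its modulus, the exponent becomes 2 - c; splitting it as (2 - 2c) +
    c exposes the weight and the variable of the covariance argument. *)
Lemma sg_powR_score (c x : R) : x != 0 ->
  Num.sg x * `|x| `^ (1 - c) * lp x
    = - (s * (`|x| `^ (2 - 2 * c) * `|x| `^ c)).
Proof.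
move=> x0; have ax0 : `|x| != 0 by rewrite normr_eq0.
rewrite -powRD; last by rewrite ax0 implybT.
have -> : 2 - 2 * c + c = (1 - c) + 1 by ring.
rewrite (powRD (r := 1 - c)); last by rewrite ax0 implybT.
rewrite powRr1// lpE {3}normrEsg; ring.
Qed.

Lemma sg_powR_score_sum (c : R) zc : (forall i, zc 0 i != 0) ->
  \sum_i Num.sg (zc 0 i) * `|zc 0 i| `^ (1 - c) * lp (zc 0 i)
    = - (s * \sum_i `|zc 0 i| `^ (2 - 2 * c) * `|zc 0 i| `^ c).
Proof.
move=> zc0; rewrite mulr_sumr -sumrN.
by apply: eq_bigr => i _; rewrite sg_powR_score.
Qed.

Lemma sg_powR_ln_score_sum (c : R) zc : (forall i, zc 0 i != 0) ->
  \sum_i Num.sg (zc 0 i) * `|zc 0 i| `^ (1 - c) * ln `|zc 0 i| * lp (zc 0 i)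
    = - (s * \sum_i `|zc 0 i| `^ (2 - 2 * c) * `|zc 0 i| `^ c * ln `|zc 0 i|).
Proof.
move=> zc0; rewrite mulr_sumr -sumrN; apply: eq_bigr => i _.
by rewrite mulrAC sg_powR_score//; ring.
Qed.

(** At c = 0 each numerator is [- s] times its denominator, so both ratios equal [- s] once the
    denominators are nonzero. *)
Lemma optimality_conditions_linear zc : (forall i, zc 0 i != 0) ->
  \sum_i zc 0 i ^+ 2 * ln `|zc 0 i| != 0 ->
  optimality_conditions lp zc (fun=> s) (fun=> 0).
Proof.
move=> zc0 ln0.
have sqE i : `|zc 0 i| `^ (2 - 2 * 0) = zc 0 i ^+ 2.
  by rewrite mulr0 subr0 powR_mulrn// real_normK// num_real.
have sqME i (u : R) : `|zc 0 i| `^ (2 - 2 * 0) * u = zc 0 i ^+ 2 * u.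
  by rewrite sqE.
have sqM1E i : `|zc 0 i| `^ (2 - 2 * 0) * `|zc 0 i| `^ 0 = zc 0 i ^+ 2.
  by rewrite sqE powRr0 mulr1.
have sqM1ME i (u : R) :
    `|zc 0 i| `^ (2 - 2 * 0) * `|zc 0 i| `^ 0 * u = zc 0 i ^+ 2 * u.
  by rewrite sqM1E.
rewrite /optimality_conditions /= sg_powR_score_sum// sg_powR_ln_score_sum//.
rewrite (eq_bigr _ (fun i _ => sqM1E i)) (eq_bigr _ (fun i _ => sqE i)).
rewrite (eq_bigr _ (fun i _ => sqM1ME i _)) (eq_bigr _ (fun i _ => sqME i _)).
(* If the squares summed to 0, each would vanish and so would the logarithmic sum; this also covers
   d = 0. *)
have sq0 : \sum_i zc 0 i ^+ 2 != 0.
  apply: contraNneq ln0 => /eqP; rewrite psumr_eq0; last first.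
    by move=> i _; exact: sqr_ge0.
  by move=> /allP h; rewrite big1// => i _;
    have /eqP-> := h i (mem_index_enum _); rewrite mul0r.
by split; field; rewrite ?ln0 ?sq0.
Qed.

Lemma optimality_tuning_eq zc t c : 0 < s -> 0 <= c (vabs zc) ->
  (forall i, zc 0 i != 0) -> optimality_conditions lp zc t c ->
  (exists i j, `|zc 0 i| != `|zc 0 j|) ->
  c (vabs zc) = 0 /\ t (vabs zc) = s.
Proof.
move=> s0 c0 zc0; rewrite /optimality_conditions /=.
set k := c (vabs zc) in c0 *.
rewrite sg_powR_score_sum// sg_powR_ln_score_sum//.
have a0 i : 0 < `|zc 0 i| by rewrite normr_gt0.
set W := \sum_i `|zc 0 i| `^ (2 - 2 * k).
set X := \sum_i `|zc 0 i| `^ (2 - 2 * k) * `|zc 0 i| `^ k.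
set Y := \sum_i `|zc 0 i| `^ (2 - 2 * k) * ln `|zc 0 i|.
set Z := \sum_i `|zc 0 i| `^ (2 - 2 * k) * `|zc 0 i| `^ k * ln `|zc 0 i|.
move=> [tE eqXZ] [i [j aij]].
(* The index [i] makes the index set nonempty, hence the strict inequality. *)
have psum_gt0 (F : 'I_d -> R) : (forall k, 0 < F k) -> 0 < \sum_k F k.
  move=> F0; rewrite (bigD1 i)//= ltr_pwDl// sumr_ge0// => l _; exact: ltW.
have W0 : 0 < W by apply: psum_gt0 => l; rewrite powR_gt0.
have X0 : 0 < X by apply: psum_gt0 => l; rewrite mulr_gt0 ?powR_gt0.
(* Division by zero gives 0, which the nonzero left-hand side excludes. *)
have Y0 : Y != 0.
  apply: contra_eq_neq eqXZ => ->; rewrite invr0 mulr0.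
  by rewrite mulNr oppr_eq0 gt_eqF// divr_gt0// mulr_gt0.
(* Cross-multiplying the second condition and cancelling [s] gives zero weighted covariance. *)
have cov : X * Y = W * Z.
  apply: (mulfI (lt0r_neq0 s0)).
  have WN0 := lt0r_neq0 W0.
  move: eqXZ => /eqP; rewrite eqr_div// => /eqP; lra.
have k0 : k = 0.
  move: c0; rewrite le_eqVlt => /predU1P[//|k_gt0].
  (* By contraposition, from the monotonicity of the power with exponent [k]. *)
  have powR_ltW l m : `|zc 0 l| `^ k < `|zc 0 m| `^ k ->
      ln `|zc 0 l| < ln `|zc 0 m|.
    rewrite ltr_ln ?posrE// !ltNge; apply: contra => aml.
    by apply: ge0_ler_powR; rewrite ?nnegrE// ltW.
  have w0 l : 0 < `|zc 0 l| `^ (2 - 2 * k) by rewrite powR_gt0.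
  have := eq_of_weighted_covariance0 R 'I_d _ _ _ w0 powR_ltW cov i j.
  by move=> /(powR_injective k_gt0) eqa; rewrite eqa ?nnegrE ?eqxx in aij.
split=> //; rewrite tE.
have -> : X = W by apply: eq_bigr => l _; rewrite k0 powRr0 mulr1.
by field; rewrite gt_eqF.
Qed.

Lemma theta_NOMAD_linear zc t c : 0 < s -> 0 <= c (vabs zc) ->
  (forall i, zc 0 i != 0) -> optimality_conditions lp zc t c ->
  theta_NOMAD t c zc = shrinkage_profile s zc.
Proof.
move=> s0 c0 zc0 opt; apply/rowP => i; rewrite !mxE.
(* This form serves both cases: multiplied by the power 1 - c it gives [s] times the modulus,
   whatever c is. *)
suff tE : t (vabs zc) = s * `|zc 0 i| `^ c (vabs zc).
  have a0 : `|zc 0 i| != 0 by rewrite normr_eq0.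
  have powRE : `|zc 0 i| `^ c (vabs zc) * `|zc 0 i| `^ (1 - c (vabs zc))
      = `|zc 0 i|.
    rewrite -powRD; last by rewrite a0 implybT.
    by rewrite addrC subrK powRr1.
  rewrite tE mulrBl mul1r; congr (_ - _).
  rewrite [in RHS](numEsg (zc 0 i)) -[in RHS]powRE; ring.
have [alleq|] := pselect (forall k, `|zc 0 k| = `|zc 0 i|); last first.
  move=> /existsNP[j /eqP aij].
  have [|-> ->] := optimality_tuning_eq zc t c s0 c0 zc0 opt.
    by exists j, i.
  by rewrite powRr0 mulr1.
(* With a common modulus, its power c factors out of the numerator and the remaining sum cancels the
   denominator. *)
case: opt => + _; rewrite /= sg_powR_score_sum// => ->.
under [X in s * X]eq_bigr do rewrite alleq.
under [X in _ / X]eq_bigr do rewrite alleq.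
rewrite -mulr_suml.
have W0 : \sum_(k < d) `|zc 0 i| `^ (2 - 2 * c (vabs zc)) != 0.
  rewrite sumr_const card_ord mulrn_eq0 negb_or powR_eq0 normr_eq0.
  by rewrite (negPf (zc0 i)) andbT -lt0n (leq_ltn_trans _ (ltn_ord i)).
by field.
Qed.

End linear_score.

Lemma ridge_family_shrinkage_profile (R : realType) (d : nat) (s : R) :
  0 < s < 1 -> ridge_family (shrinkage_profile (d := d) s).
Proof.
(* The witness solves lambda / (1 + lambda) = [s]. *)
move=> /andP[s0 s1]; exists (s / (1 - s)); first by rewrite divr_gt0// subr_gt0.
move=> zc; rewrite /shrinkage_profile; congr ((1 - _) *: _).
by field; rewrite subrK oner_eq0 subr_eq0 gt_eqF.
Qed.

Theorem proposition4 (R : realType) (d : nat) (tau : R) (f : R -> R)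
    (htau : 0 < tau) (hf : f = normal_pdf 0 tau) :
  [/\ (forall x : R, score f x = - x / tau ^+ 2),
      (forall zc : 'rV[R]_d,
        (forall i, zc 0 i != 0) ->
        \sum_i zc 0 i ^+ 2 * ln `|zc 0 i| != 0 ->
        optimality_conditions (score f) zc (fun=> tau ^- 2) (fun=> 0)),
      (forall (zc : 'rV[R]_d)
          (G : ('rV[R]_d -> R) -> ('rV[R]_d -> R) -> Prop)
          (t c : 'rV[R]_d -> R),
        (forall i, zc 0 i != 0) ->
        NOMAD_tuning (score f) zc G t c ->
        [/\ ((exists i j, `|zc 0 i| != `|zc 0 j|) ->
               c (vabs zc) = 0 /\ t (vabs zc) = tau ^- 2),
            theta_NOMAD t c zc = shrinkage_profile (tau ^- 2) zc &
            (tau ^- 2 = JS_level zc -> theta_NOMAD t c zc = theta_JS zc)]),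
      (forall zc : 'rV[R]_d,
        shrinkage_profile (JS_level zc) zc = theta_JS zc) &
      (1 < tau ^+ 2 ->
        ridge_family (shrinkage_profile (d := d) (tau ^- 2)))].
Proof.
have scoreE x : score f x = - x / tau ^+ 2.
  by rewrite hf score_normal_pdf// gt_eqF.
have lpE x : score f x = - (tau ^- 2 * x) by rewrite scoreE mulNr mulrC.
have s0 : 0 < tau ^- 2 by rewrite invr_gt0 exprn_gt0.
split=> // [zc|zc G t c zc0 [Ggest [Gtc _] opt]|tau1].
- exact: optimality_conditions_linear.
(* The inclusion of [G] in [gest_class] supplies the sign of [c] at the observation. *)
- have [_ c_ge0 _ _] := Ggest _ _ Gtc.
  have thetaE : theta_NOMAD t c zc = shrinkage_profile (tau ^- 2) zc.
    exact: (theta_NOMAD_linear _ _ lpE).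
  split=> //; first exact: (optimality_tuning_eq _ _ lpE).
  by rewrite thetaE => ->.
- apply: ridge_family_shrinkage_profile.
  by rewrite s0 invf_lt1// exprn_gt0.
Qed.
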